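(* For every integer $n\geqslant1$, $|\mathrm{PswEnd}(S_n)|=2n^{n-1}+n2^{n}-n-1$.
   Context: For $n\geqslant1$, the star graph $S_n$ is the simple graph with vertex set $\{0,1,\ldots,n-1\}$ and edge set $E=\{\{0,i\}\mid 1\leqslant i\leqslant n-1\}$. For a finite simple graph $G=(V,E)$, $\mathrm{PswEnd}(G)$ is the set of all partial strong weak endomorphisms of $G$, i.e. partial maps $\alpha:V\to V$ (including the empty one; written on the right) such that for all $u,v\in\mathrm{Dom}(\alpha)$: ($\{u,v\}\in E$ and $u\alpha\neq v\alpha$) if and only if $\{u\alpha,v\alpha\}\in E$. *)

(* Defs.v *)
From HB Require Import structures.
From mathcomp Require Import all_boot.

Set Implicit Arguments.
Unset Strict Implicit.
Unset Printing Implicit Defensive.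

Record sgraph (V : finType) := SGraph {
  adj : rel V;
  adj_sym : symmetric adj;
  adj_irrefl : irreflexive adj }.

Definition star_rel (n : nat) : rel 'I_n :=
  fun u v => ((val u == 0) && (0 < val v)) || ((val v == 0) && (0 < val u)).

Lemma star_rel_sym n : symmetric (@star_rel n).
Proof. by move=> u v; rewrite /star_rel orbC. Qed.

Lemma star_rel_irrefl n : irreflexive (@star_rel n).
Proof. by move=> u; rewrite /star_rel orbb; case: (val u). Qed.

Definition star (n : nat) : sgraph 'I_n :=
  SGraph (@star_rel_sym n) (@star_rel_irrefl n).

(* A partial map V -> V is a finite function V -> option V, where None means
   "undefined"; thus Dom(a) is the set of u with a u != None, and the empty
   map is the constant None. *)
Definition partial_map (V : finType) := {ffun V -> option V}.

Definition partial_strong_weak_endo (V : finType) (G : sgraph V)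
    (a : partial_map V) : bool :=
  [forall u, forall v,
     if (a u, a v) is (Some x, Some y)
     then (adj G u v && (x != y)) == adj G x y
     else true].

Definition PswEnd (V : finType) (G : sgraph V) : {set {ffun V -> option V}} :=
  [set a | partial_strong_weak_endo G a].

(* Main.v *)
(* Fix the image [c] of the centre. Since distinct leaves are never adjacent,
   the defined leaves go either all to the centre or all to leaves; adjacency
   to the centre restricts the second alternative only when [c] is a leaf, in
   which case [c] is the only leaf available. With [n = m + 1], these
   alternatives share exactly one map (undefined on all leaves), so the fibre
   over [c] has [n ^ m + 2 ^ m - 1] elements if [c] is undefined or the centre,
   and [2 ^ m + 2 ^ m - 1] if [c] is one of the [m] leaves. *)
Require Import Defs.
From HB Require Import structures.
From mathcomp Require Import all_boot.
From mathcomp Require Import zify.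

(** With adjacency as an exclusive or, the endomorphism condition becomes a Boolean identity in
    which vertices are compared only with the centre and images with each other. *)
Lemma star_adjE m (u v : 'I_m.+1) :
  adj (star m.+1) u v = (u == ord0) (+) (v == ord0).
Proof.
rewrite /= /star_rel -!(inj_eq val_inj) /= !lt0n.
by case: (val u == 0); case: (val v == 0).
Qed.

(** [None] is always allowed, since any leaf may be left undefined. *)
Definition leaf_images m (c : option 'I_m.+1) : {set option 'I_m.+1} :=
  if c is Some j then
    if j == ord0 then [set~ Some ord0] else [set None; Some j]
  else [set~ Some ord0].

Definition centre_images m : {set option 'I_m.+1} := [set None; Some ord0].

Definition leaves_into m (S : {set option 'I_m.+1})
    (a : {ffun 'I_m.+1 -> option 'I_m.+1}) : bool :=
  [forall i, (i != ord0) ==> (a i \in S)].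

Lemma PswEnd_starE m (a : {ffun 'I_m.+1 -> option 'I_m.+1}) :
  (a \in PswEnd (star m.+1)) =
  leaves_into m (leaf_images m (a ord0)) a || leaves_into m (centre_images m) a.
Proof.
rewrite inE; apply/idP/idP.
  move=> /forallP Ha.
  have H u v x y : a u = Some x -> a v = Some y ->
    ((u == ord0) (+) (v == ord0)) && (x != y) = (x == ord0) (+) (y == ord0).
    move=> au av; move/forallP: (Ha u) => /(_ v); rewrite au av => /eqP.
    by rewrite !star_adjE.
  case: (boolP (leaves_into m (centre_images m) a)); rewrite ?orbT // orbF.
  rewrite negb_forall => /existsP [u]; rewrite negb_imply => /andP [u0].
  rewrite !inE; case au: (a u) => [x|] //=; rewrite (inj_eq Some_inj) => x0.
  (* The leaf [u], sent to a leaf [x], serves as a witness: no leaf [v] is adjacent to [u], so the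
     image of [v] cannot be the centre. *)
  apply/forallP => v; apply/implyP => v0.
  case av: (a v) => [y|]; last first.
    rewrite /leaf_images; case: (a ord0) => [j|]; rewrite ?inE //.
    by case: ifP; rewrite !inE.
  have y0 : y != ord0.
    have := H _ _ _ _ au av.
    by rewrite (negbTE u0) (negbTE v0) (negbTE x0) /= => <-.
  rewrite /leaf_images; case a0: (a ord0) => [j|]; last first.
    by rewrite !inE (inj_eq Some_inj).
  have [_|j0] := eqVneq j ord0; rewrite !inE (inj_eq Some_inj) //=.
  (* The centre is adjacent to [v], but the leaves [j] and [y] are not adjacent, so they must
     coincide. *)
  have := H _ _ _ _ a0 av.
  rewrite eqxx (negbTE v0) (negbTE y0) (negbTE j0) /= => /negbFE.
  by rewrite eq_sym.
move=> Ha; apply/forallP => u; apply/forallP => v.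
case au: (a u) => [x|] //; case av: (a v) => [y|] //.
rewrite !star_adjE; apply/eqP.
case/orP: Ha => /forallP Ha; move: (Ha u) (Ha v); rewrite au av.
- have [u0|u0] := eqVneq u ord0; have [v0|v0] := eqVneq v ord0 => /=.
  + by move: av; rewrite v0 -u0 au => -[->]; rewrite addbb.
  + move=> _; rewrite -[in a _]u0 au /leaf_images.
    have [->|x0] := eqVneq x ord0; rewrite !inE !(inj_eq Some_inj) /=.
      by rewrite eq_sym => /negbTE ->.
    by move/eqP->; rewrite eqxx (negbTE x0).
  + move=> + _; rewrite -[in a _]v0 av /leaf_images.
    have [->|y0] := eqVneq y ord0; rewrite !inE !(inj_eq Some_inj) /=.
      by move/negbTE ->.
    by move/eqP->; rewrite eqxx (negbTE y0).
  + rewrite /leaf_images; case: (a ord0) => [j|]; last first.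
      by rewrite !inE !(inj_eq Some_inj) => /negbTE-> /negbTE->.
    have [_|j0] := eqVneq j ord0; rewrite !inE !(inj_eq Some_inj) /=.
      by move=> /negbTE-> /negbTE->.
    by move=> /eqP-> /eqP->; rewrite addbb.
(* A leaf sent to the centre fits any image of the centre: a vertex is adjacent to [ord0] exactly
   when it differs from it. *)
- rewrite !inE !(inj_eq Some_inj) /=.
  have [u0|u0] := eqVneq u ord0; have [v0|v0] := eqVneq v ord0 => /=.
  + by move: av; rewrite v0 -u0 au => -[->]; rewrite addbb.
  + by move=> _ /eqP->; rewrite eqxx addbT.
  + by move=> /eqP-> _; rewrite eqxx eq_sym.
  + by move=> /eqP-> /eqP->; rewrite addbb.
Qed.

(** The values are chosen independently: such maps form a [family] with a singleton at the centre
    and [S] at each of the [m] leaves. *)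
Lemma card_leaves_into m (c : option 'I_m.+1) (S : {set option 'I_m.+1}) :
  #|[set a : {ffun 'I_m.+1 -> option 'I_m.+1} |
      (a ord0 == c) && leaves_into m S a]| = #|S| ^ m.
Proof.
pose F (i : 'I_m.+1) := if i == ord0 then [set c] else S.
rewrite (_ : #|_| = #|family F|).
  rewrite card_family foldrE big_map big_enum /= big_ord_recl /F eqxx cards1.
  rewrite mul1n (eq_bigr (fun=> #|S|)) // prod_nat_const card_ord //.
apply: eq_card => a; rewrite inE; apply/andP/familyP.
  move=> [/eqP a0 /forallP aS] i; rewrite /F; case: eqVneq => [->|i0].
    by rewrite a0 set11.
  by move: (aS i); rewrite i0.
move=> aF; split; first by have := aF ord0; rewrite /F eqxx inE.
by apply/forallP => i; apply/implyP => /negbTE i0; have := aF i; rewrite /F i0.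
Qed.

Lemma card_centre_images m : #|centre_images m| = 2.
Proof. by rewrite cards2. Qed.

Lemma leaf_centre_images m (c : option 'I_m.+1) :
  leaf_images m c :&: centre_images m = [set None].
Proof.
rewrite /leaf_images; apply/setP => x.
case: c => [j|]; first have [_|j0] := eqVneq j ord0; rewrite !inE;
  case: x => [x|] //=; rewrite ?andNb // !(inj_eq Some_inj).
by have [->|] := eqVneq x j; rewrite ?(negbTE j0).
Qed.

Lemma card_PswEnd_star_fiber m (c : option 'I_m.+1) :
  #|[set a in PswEnd (star m.+1) | a ord0 == c]| =
  #|leaf_images m c| ^ m + 2 ^ m - 1.
Proof.
pose T S := [set a : {ffun 'I_m.+1 -> option 'I_m.+1} |
  (a ord0 == c) && leaves_into m S a].
have -> : [set a in PswEnd (star m.+1) | a ord0 == c] =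
    T (leaf_images m c) :|: T (centre_images m).
  apply/setP => a; rewrite in_set PswEnd_starE !inE andbC.
  by case: eqP => [->|].
(* Intersecting the two alternatives intersects the allowed values, so inclusion-exclusion subtracts
   [1 ^ m]. *)
have TI : T (leaf_images m c) :&: T (centre_images m) = T [set None].
  apply/setP => a; rewrite -(leaf_centre_images m c) !inE.
  case: eqP => //= _; apply/andP/forallP => [[/forallP H1 /forallP H2] i|H].
    by apply/implyP => i0; rewrite inE; move: (H1 i) (H2 i); rewrite i0 /= => -> ->.
  by split; apply/forallP => i; move: (H i); case: (i != ord0) => //=;
    rewrite inE => /andP [].
by rewrite cardsU TI /T !card_leaves_into card_centre_images cards1 exp1n.
Qed.

Lemma card_set_fibers (A B : finType) (f : A -> B) (S : {set A}) :
  #|S| = \sum_(b : B) #|[set a in S | f a == b]|.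
Proof.
rewrite -sum1_card (partition_big f xpredT) //=.
by apply: eq_bigr => b _; rewrite -sum1_card; apply: eq_bigl => a; rewrite inE.
Qed.

Theorem corollary1p9 (n : nat) (hn : 1 <= n) :
  #|PswEnd (star n)| = 2 * n ^ (n - 1) + n * 2 ^ n - n - 1.
Proof.
case: n hn => // m _.
rewrite (card_set_fibers _ _ (fun a : {ffun 'I_m.+1 -> _} => a ord0)).
rewrite (eq_bigr _ (fun c _ => card_PswEnd_star_fiber m c)).
have cC : #|[set~ Some (@ord0 m)]| = m.+1.
  by rewrite cardsC1 card_option card_ord.
(* The two large fibres are split off; the [m] remaining ones have equal size. *)
rewrite (bigD1 None) //= cC (bigD1 (Some ord0)) //= cC.
rewrite (eq_bigr (fun=> 2 ^ m + 2 ^ m - 1)); last first.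
  move=> [j|] //=; rewrite (inj_eq Some_inj) => /negbTE ->.
  by rewrite cards2.
rewrite sum_nat_const.
have -> : #|[pred i | (i != None) && (i != Some (@ord0 m))]| = m.
  have := cardsC [set None; Some (@ord0 m)].
  rewrite cards2 card_option card_ord /= => /eqP; rewrite !eqSS => /eqP cL.
  by rewrite -[RHS]cL; apply: eq_card => x; rewrite !inE negb_or.
rewrite [m.+1 - 1]subn1 expnS.
have : 0 < 2 ^ m by rewrite expn_gt0.
have : 0 < m.+1 ^ m by rewrite expn_gt0.
move: (m.+1 ^ m) (2 ^ m) => p q p0 q0.
(* With the positivity of [p] and [q], this keeps the truncated subtractions exact; [lia] then
   treats [m * q] as an atom. *)
have : m <= m * q by rewrite leq_pmulr.
rewrite mulnBr mulnDr muln1 (mulnCA m.+1) (mulSn m); lia.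
Qed.
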